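(* Let $X$ be a topological space. If $X$ is Scheepers, then the Alexandroff duplicate $AD(X)$ is strongly star-Scheepers and hence star-Scheepers.
   Context: The Alexandroff duplicate of $X$ is $AD(X)=X\times\{0,1\}$, where each point of $X\times\{1\}$ is isolated and basic neighbourhoods of $(x,0)$ are the sets $(U\times\{0\})\cup((U\times\{1\})\setminus\{(x,1)\})$ with $U$ a neighbourhood of $x$ in $X$. For $A\subseteq X$ and a family $\mathcal{P}$ of subsets of $X$, $St(A,\mathcal{P})=\bigcup\{B\in\mathcal{P} : A\cap B\neq\emptyset\}$. An $\omega$-cover of $X$ is an open cover $\mathcal{U}$ such that every finite $F\subseteq X$ is contained in some member of $\mathcal{U}$. $X$ is Scheepers if for each sequence $(\mathcal{U}_n)_{n\in\mathbb{N}}$ of open covers of $X$ there are finite $\mathcal{V}_n\subseteq\mathcal{U}_n$ such that $\{\bigcup\mathcal{V}_n : n\in\mathbb{N}\}$ is an $\omega$-cover of $X$ or $\bigcup\mathcal{V}_n=X$ for some $n$. $X$ is star-Scheepers if for each such sequence there are finite $\mathcal{V}_n\subseteq\mathcal{U}_n$ such that $\{St(\bigcup\mathcal{V}_n,\mathcal{U}_n) : n\in\mathbb{N}\}$ is an $\omega$-cover of $X$ or $St(\bigcup\mathcal{V}_n,\mathcal{U}_n)=X$ for some $n$. $X$ is strongly star-Scheepers if for each such sequence there are finite sets $F_n\subseteq X$ such that $\{St(F_n,\mathcal{U}_n) : n\in\mathbb{N}\}$ is an $\omega$-cover of $X$. *)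

(* Defs.v *)
From HB Require Import structures.
From mathcomp Require Import all_boot.
From mathcomp Require Import all_classical.
From mathcomp Require Import topology.

Set Implicit Arguments.
Unset Strict Implicit.
Unset Printing Implicit Defensive.

Local Open Scope classical_set_scope.

(* [(x, false)] stands for (x, 0) and [(x, true)] for (x, 1).  This alias keeps
   the duplicate topology apart from the product topology on [X * bool]. *)
Definition alexandroff_duplicate (X : Type) : Type := (X * bool)%type.

Definition AD_basic_nbhs {X : Type} (x : X) (U : set X) :
    set (alexandroff_duplicate X) :=
  (U `*` [set false]) `|` ((U `*` [set true]) `\ (x, true)).

(* A set is open when it contains a basic neighbourhood of each of its points;
   the points [(x, true)] are isolated and impose no condition.  For a space
   that is not T1 a basic neighbourhood need not be a neighbourhood of its other
   points, so declaring the basic sets to be the neighbourhood filters would not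
   always yield a topology; see [AD_nbhs_false]. *)
Definition AD_open {X : topologicalType} :
    set_system (alexandroff_duplicate X) :=
  [set A | forall x : X, A (x, false) ->
     exists2 U, nbhs x U & AD_basic_nbhs x U `<=` A].

Section alexandroff_duplicate_topology.
Context {X : topologicalType}.

Let AD_openT : AD_open [set: alexandroff_duplicate X].
Proof. by move=> x _; exists setT => //; exact: filterT. Qed.

Let AD_openI : setI_closed (@AD_open X).
Proof.
move=> A B Aop Bop x [/Aop[U xU UA] /Bop[V xV VB]].
exists (U `&` V); first exact: filterI.
move=> [y b] [[[/= Uy Vy] yb]|[[[/= Uy Vy] yb] yx]].
  by split; [apply: UA|apply: VB]; left.
by split; [apply: UA|apply: VB]; right.
Qed.

Let AD_open_bigU (I : Type) (f : I -> set (alexandroff_duplicate X)) :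
  (forall i, AD_open (f i)) -> AD_open (\bigcup_i f i).
Proof.
move=> fop x [i _ /(fop i)[U xU Uf]]; exists U => // p /Uf fp.
by exists i.
Qed.

HB.instance Definition _ :=
  Choice.copy (alexandroff_duplicate X) (X * bool)%type.

HB.instance Definition _ := isOpenTopological.Build (alexandroff_duplicate X)
  AD_openT AD_openI AD_open_bigU.

Lemma AD_openE : @open (alexandroff_duplicate X) = AD_open.
Proof. by []. Qed.

Lemma AD_open_true (x : X) : open [set ((x, true) : alexandroff_duplicate X)].
Proof. by move=> y. Qed.

Lemma AD_nbhs_true (x : X) :
  nbhs ((x, true) : alexandroff_duplicate X) = principal_filter (x, true).
Proof.
apply/seteqP; split => A; rewrite principal_filterP; first exact: nbhs_singleton.
move=> Ax; rewrite nbhsE; exists [set (x, true)]; last by move=> _ ->.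
by split => //; exact: AD_open_true.
Qed.

Lemma AD_nbhs_false (x : X) : accessible_space X ->
  nbhs ((x, false) : alexandroff_duplicate X) =
  filter_from (nbhs x) (AD_basic_nbhs x).
Proof.
move=> X1; rewrite [LHS]nbhsE; apply/seteqP; split => A.
  move=> [B [Bop /Bop[U xU UB]] BA].
  by exists U => //; exact: subset_trans UB BA.
move=> [U xU UA]; exists (AD_basic_nbhs x U°); last first.
  move=> p [[/= Up pb]|[[/= Up pb] px]]; apply: UA.
    by left; split => //; exact: interior_subset.
  by right; split => //; split => //; exact: interior_subset.
split; last by left.
move=> y yU; have {}Uy : nbhs y U° by case: yU => [[/= /nbhs_interior]|[[]]].
have [->|yx] := eqVneq y x; first by exists U° => //; exact: nbhs_interior.
have [V [Vop [/set_mem Vy /set_mem Vx]]] := X1 _ _ yx.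
exists (U° `&` V); first by apply: filterI => //; exact: open_nbhs_nbhs.
move=> [z b] [[/= [Uz Vz] zb]|[[/= [Uz Vz] zb] zy]]; first by left.
by right; split => //= -[zx _]; apply: Vx; rewrite -zx.
Qed.

End alexandroff_duplicate_topology.

Definition star {T : Type} (A : set T) (P : set (set T)) : set T :=
  \bigcup_(B in [set B | P B /\ A `&` B !=set0]) B.

Definition open_cover {X : topologicalType} (U : set (set X)) : Prop :=
  U `<=` open /\ \bigcup_(B in U) B = setT.

Definition omega_cover {X : topologicalType} (U : set (set X)) : Prop :=
  open_cover U /\
  forall F : set X, finite_set F -> exists2 B, U B & F `<=` B.

Definition scheepers (X : topologicalType) : Prop :=
  forall U : nat -> set (set X), (forall n, open_cover (U n)) ->
  exists V : nat -> set (set X),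
    (forall n, finite_set (V n) /\ V n `<=` U n) /\
    (omega_cover (range (fun n => \bigcup_(B in V n) B)) \/
     exists n, \bigcup_(B in V n) B = setT).

Definition star_scheepers (X : topologicalType) : Prop :=
  forall U : nat -> set (set X), (forall n, open_cover (U n)) ->
  exists V : nat -> set (set X),
    (forall n, finite_set (V n) /\ V n `<=` U n) /\
    (omega_cover (range (fun n => star (\bigcup_(B in V n) B) (U n))) \/
     exists n, star (\bigcup_(B in V n) B) (U n) = setT).

Definition strongly_star_scheepers (X : topologicalType) : Prop :=
  forall U : nat -> set (set X), (forall n, open_cover (U n)) ->
  exists F : nat -> set X,
    (forall n, finite_set (F n)) /\
    omega_cover (range (fun n => star (F n) (U n))).

(* Main.v *)
(** Shrink each member of an open cover of [AD(X)] around [(x, 0)] to a basic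
    neighbourhood built on an open [O x] of [X].  The Scheepers selection gives
    finite sets [G n] of points whose [O x] capture every finite subset of [X].
    The star of [G n] times [{0, 1}] contains [O x] times [{0, 1}] for each [x]
    in [G n]: the only point missed by the basic neighbourhood at [(x, 0)] is
    [(x, 1)], which belongs to the set being starred. *)
Require Import Defs.
From mathcomp Require Import all_boot.
From mathcomp Require Import all_classical.
From mathcomp Require Import topology.

Local Open Scope classical_set_scope.

Lemma open_cover_mem {X : topologicalType} {U : set (set X)} (x : X) :
  open_cover U -> exists2 B, U B & B x.
Proof. by move=> [_ UT]; have : [set: X] x by []; rewrite -UT => -[B]; exists B. Qed.

Lemma open_star {X : topologicalType} (A : set X) {U : set (set X)} :
  open_cover U -> open (star A U).
Proof. by move=> [Uop _]; apply: bigcup_open => B [/Uop]. Qed.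

Lemma star_subl {T : Type} {A B : set T} (P : set (set T)) :
  A `<=` B -> star A P `<=` star B P.
Proof.
move=> AB y [C [PC [z [Az Cz]]] Cy].
by exists C => //; split => //; exists z; split => //; exact: AB.
Qed.

Lemma subset_star {X : topologicalType} (A : set X) {U : set (set X)} :
  open_cover U -> A `<=` star A U.
Proof.
move=> cU x Ax; have [B UB Bx] := open_cover_mem x cU.
by exists B => //; split => //; exists x.
Qed.

Lemma omega_cover_range {X : topologicalType} (S : nat -> set X) :
  (forall n, open (S n)) ->
  (forall F, finite_set F -> exists n, F `<=` S n) ->
  omega_cover (range S).
Proof.
move=> Sop Sfin; split; last first.
  by move=> F /Sfin[n FS]; exists (S n) => //; exists n.
split=> [_ [n _ <-]//|]; apply/seteqP; split=> // x _.
have [n xS] := Sfin _ (finite_set1 x).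
by exists (S n); [exists n|exact: xS].
Qed.

(** Trades finite families of open sets for finite sets of centres, which is what a strong star
    selection asks for, and merges the two alternatives of [scheepers] into one. *)
Lemma scheepers_indexed {X : topologicalType} (O : nat -> X -> set X) :
  scheepers X ->
  (forall n x, open (O n x)) -> (forall n x, O n x x) ->
  exists G : nat -> set X,
    (forall n, finite_set (G n)) /\
    forall F, finite_set F -> exists n, F `<=` \bigcup_(x in G n) O n x.
Proof.
move=> SX Oop Ox.
have [|V [Vfin Vcov]] := SX (fun n => range (O n)).
  move=> n; split=> [_ [x _ <-]//|]; apply/seteqP; split=> // x _.
  by exists (O n x) => //; exists x.
(* Choosing a set of at most one centre, instead of a point, leaves the empty set as default when
   [p.2] is no [O p.1 x]; thus [X] may be empty. *)
have /choice[c cP] (p : nat * set X) : exists x : set X,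
    finite_set x /\ (range (O p.1) p.2 -> p.2 `<=` \bigcup_(z in x) O p.1 z).
  have [[x _ Ox']|nO] := pselect (range (O p.1) p.2); last by exists set0.
  exists [set x]; split=> // _; rewrite bigcup_set1 Ox'; exact: subset_refl.
have Gsub n : \bigcup_(B in V n) B `<=`
    \bigcup_(x in \bigcup_(B in V n) c (n, B)) O n x.
  move=> y [B VB By]; have [finV VO] := Vfin n.
  have [_ /(_ (VO _ VB) _ By)[z cz Oz]] := cP (n, B).
  by exists z => //; exists B.
exists (fun n => \bigcup_(B in V n) c (n, B)); split=> [n|F Ffin].
  by apply: bigcup_finite => [|B _]; [have [] := Vfin n|have [] := cP (n, B)].
(* In the second alternative a single [n] serves every finite [F]. *)
case: Vcov => [[_ /(_ _ Ffin)[_ [n _ <-] FV]]|[n VT]]; exists n.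
  exact: subset_trans FV (Gsub n).
by apply: subset_trans (Gsub n); rewrite VT.
Qed.

(** Replace each point of [F n] by a member of [U n] containing it: the union of these members
    contains [F n], and stars are monotone. *)
Lemma strongly_star_scheepersW {X : topologicalType} :
  strongly_star_scheepers X -> star_scheepers X.
Proof.
move=> SX U cU; have [F [Ffin [_ Fcov]]] := SX U cU.
have /choice[B BP] (p : nat * X) : exists B, U p.1 B /\ B p.2.
  by have [B] := open_cover_mem p.2 (cU p.1); exists B.
exists (fun n => (fun x => B (n, x)) @` F n); split.
  move=> n; split; first exact/finite_image/Ffin.
  by move=> _ [x _ <-]; have [] := BP (n, x).
left; apply: omega_cover_range => [n|A /Fcov[_ [n _ <-] AF]].
  exact: open_star.
exists n; apply: subset_trans AF _; apply: star_subl => x Fx.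
by exists (B (n, x)); [exists x|have [] := BP (n, x)].
Qed.

Lemma scheepers_alexandroff_duplicate {X : topologicalType} :
  scheepers X -> strongly_star_scheepers (alexandroff_duplicate X).
Proof.
move=> SX U cU.
have /choice[O OP] (p : nat * X) : exists O : set X, [/\ open O, O p.2 &
    exists2 W, U p.1 W & W (p.2, false) /\ AD_basic_nbhs p.2 O `<=` W].
  have [W UW Wp] := open_cover_mem ((p.2, false) : alexandroff_duplicate X) (cU p.1).
  have [/(_ _ UW)/(_ _ Wp)[N pN NW] _] := cU p.1.
  (* [N] is only a neighbourhood, whereas [scheepers_indexed] requires open sets. *)
  exists N°; split; [exact: open_interior|exact: pN|exists W => //; split=> //].
  move=> q [[/= Nq qb]|[[/= Nq qb] qp]]; apply: NW.
    by left; split=> //; exact: interior_subset.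
  by right; split=> //; split=> //; exact: interior_subset.
have [||G [Gfin Gcov]] := scheepers_indexed (fun n x => O (n, x)) SX.
- by move=> n x; have [] := OP (n, x).
- by move=> n x; have [] := OP (n, x).
exists (fun n => G n `*` setT); split=> [n|].
  by apply: finite_setX; [exact: Gfin|exact: finite_finset].
apply: omega_cover_range => [n|F Ffin]; first exact: open_star.
(* Projecting to [X] suffices, because the star will catch both copies of each point of
   [O (n, x)]. *)
have [n FG] := Gcov _ (finite_image fst Ffin).
exists n => -[y b] Fyb.
have [|x Gx Oy] := FG y; first by exists (y, b).
have [_ _ [W UW [Wx OW]]] := OP (n, x).
have [-> |yx] := eqVneq ((y, b) : X * bool) (x, true).
  exact: subset_star.
(* [W] meets the starred set at its own centre [(x, false)], so all of [W] lies in the star. *)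
exists W; first by split=> //; exists (x, false).
apply: OW; case: b yx {Fyb} => yx; last by left.
by right; split=> //= /eqP; apply/negP.
Qed.

Theorem corollary3p31 (X : topologicalType) :
  scheepers X ->
  strongly_star_scheepers (alexandroff_duplicate X) /\
  star_scheepers (alexandroff_duplicate X).
Proof.
move=> /scheepers_alexandroff_duplicate SX.
by split=> //; exact: strongly_star_scheepersW.
Qed.
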